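(* There exists a constant $0<\alpha_0\le1/20$ such that if $d\le\alpha_0\frac{N}{\log N}$ then, for every $d$-partition $\Lambda$ of $\{1,\dots,N\}$ and every $x\in\mathcal S_d=\{-1,1\}^d$, the associated lumped chain satisfies $$0\le\Bigl(1-\frac1N\Bigr)-\mathbb P^\circ(\tau^x_0<\tau^x_x)\le\frac{3}{N^2}\bigl(1+O(1/\sqrt N)\bigr).$$
   Context: Let $(\sigma_N(t))_{t\in\mathbb N}$ be the discrete-time simple random walk on $\{-1,1\}^N$ (jump to each Hamming neighbour with probability $1/N$). A $d$-partition $\Lambda$ is a partition of $\{1,\dots,N\}$ into nonempty classes $\Lambda_1,\dots,\Lambda_d$. Let $\gamma(\sigma)=(\gamma_1(\sigma),\dots,\gamma_d(\sigma))$ with $\gamma_k(\sigma)=|\Lambda_k|^{-1}\sum_{i\in\Lambda_k}\sigma_i$, $\Gamma_{N,d}=\gamma(\{-1,1\}^N)\supset\{-1,1\}^d$. The lumped chain $X_N(t)=\gamma(\sigma_N(t))$ is a Markov chain on $\Gamma_{N,d}$ with transition probabilities $r_N(x,x+s\frac{2}{|\Lambda_k|}u_k)=\frac{|\Lambda_k|}{N}\frac{1-sx_k}{2}$ ($s\in\{\pm1\}$, $u_k$ canonical basis vectors) and reversible invariant measure $\mathbb Q_N(x)=2^{-N}\prod_k\binom{|\Lambda_k|}{|\Lambda_k|(1+x_k)/2}$. $\mathbb P^\circ$ is its law; $\tau^x_J=\inf\{t>0:X_N(t)\in J\}$ for the chain started at $x$ (and $\tau^x_y=\tau^x_{\{y\}}$).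 The symbol $0$ denotes a fixed point of $\Gamma_{N,d}$ at which $\mathbb Q_N$ attains its maximum (the origin when all $|\Lambda_k|$ are even). *)

(* Defs.v *)
From HB Require Import structures.
From mathcomp Require Import all_boot all_order all_algebra.
From mathcomp Require Import all_classical all_reals all_analysis.
From mathcomp Require Import Rstruct Rstruct_topology.
From Stdlib Require Rdefinitions.
Notation R := Rdefinitions.R.

Set Implicit Arguments.
Unset Strict Implicit.
Unset Printing Implicit Defensive.

Import Order.TTheory GRing.Theory Num.Theory.
Local Open Scope ring_scope.

(* A d-partition of {1,..,N} (indexed here by 'I_N) into nonempty classes
   Lambda_1..Lambda_d (indexed by 'I_d) is a surjective map lam : 'I_N -> 'I_d,
   Lambda_k = lam^{-1}(k). *)
Definition is_dpartition (N d : nat) (lam : 'I_N -> 'I_d) : Prop :=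
  forall k : 'I_d, exists i : 'I_N, lam i = k.

Definition csize (N d : nat) (lam : 'I_N -> 'I_d) (k : 'I_d) : nat :=
  #|[set i | lam i == k]|.

(* Points of Gamma_{N,d}, encoded by the number n_k of +1 spins in each class
   (0 <= n_k <= |Lambda_k|); the actual point is [gcoord] below. *)
Definition state (N d : nat) (lam : 'I_N -> 'I_d) :=
  {n : {ffun 'I_d -> 'I_N.+1} | [forall k, ((n k : nat) <= csize lam k)%N]}.

(* gamma_k = |Lambda_k|^{-1} sum_{i in Lambda_k} sigma_i = (2 n_k - |Lambda_k|)/|Lambda_k| *)
Definition gcoord (N d : nat) (lam : 'I_N -> 'I_d) (y : state lam) (k : 'I_d) : R :=
  (((2 * (sval y k : nat))%:R - (csize lam k)%:R) / (csize lam k)%:R).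

Definition rN (N d : nat) (lam : 'I_N -> 'I_d) (y z : state lam) : R :=
  \sum_(k < d) \sum_(s <- [:: 1; -1])
     (if [forall j, gcoord z j == gcoord y j + (if j == k then s * 2 / (csize lam k)%:R else 0)]
      then (csize lam k)%:R / N%:R * ((1 - s * gcoord y k) / 2)
      else 0).

(* invariant measure Q_N(y) = 2^{-N} prod_k binom(|Lambda_k|, |Lambda_k|(1+y_k)/2),
   where |Lambda_k|(1+y_k)/2 = n_k *)
Definition QN (N d : nat) (lam : 'I_N -> 'I_d) (y : state lam) : R :=
  (2%:R ^- N) * \prod_(k < d) ('C(csize lam k, sval y k))%:R.

(* For a Markov kernel P on a finite type: hitb P A B t y = probability, for the
   chain started at y, that it enters A at some time s <= t, and has not entered
   B at times 0..s (A checked first). *)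
Fixpoint hitb (T : finType) (P : T -> T -> R) (A B : pred T) (t : nat) (y : T) : R :=
  match t with
  | 0 => if A y then 1 else 0
  | t'.+1 => if A y then 1 else if B y then 0
             else \sum_(z : T) P y z * hitb P A B t' z
  end.

(* P(tau^x_A < tau^x_B) with tau^x_J = inf {t > 0 : X(t) in J}, chain started at x:
   limit as t -> oo of P(tau^x_A < tau^x_B, tau^x_A <= t+1) (first step made explicitly). *)
Definition hit_before (T : finType) (P : T -> T -> R) (A B : pred T) (x : T) : R :=
  limn (fun t => \sum_(z : T) P x z * hitb P A B t z).

(* Main.v *)
Require Import Defs.
From HB Require Import structures.
From mathcomp Require Import all_boot all_order all_algebra.
From mathcomp Require Import all_classical all_reals all_analysis.
From mathcomp Require Import Rstruct Rstruct_topology.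
From mathcomp Require Import ring lra zify.
From Stdlib Require Rdefinitions.

(* Let V be the probability, as a function on the hypercube, that the lumped
   chain hits o before x. It is harmonic off x and the fiber O of o, with V = 0
   at x and V = 1 on O, so its Dirichlet energy (the sum of squared increments
   over the edges of the cube) is N p, where p is the escape probability from x.
   The fiber O carries at least the fraction (N+1)^(-d) of the cube, because o
   maximizes Q_N and there are at most (N+1)^d states; this is where the bound
   on d enters. Since p <= 1, the Poincare inequality of the cube forces the mean
   of V to be close to 1, first by looking at O and then on the level at distance
   7 from x: the average of V there is 1 - O(N^-3). Thomson's principle for the
   flow that spreads uniformly from x to level 7 then bounds p from below by
   about 1 / sum_(j < 7) 1 / C(N-1, j) = 1 - 1/N - 2/N^2 + O(N^-3). The upper
   bound holds because x is hit at the second step with probability 1/N. *)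

Set Implicit Arguments.
Unset Strict Implicit.
Unset Printing Implicit Defensive.

Import Order.TTheory GRing.Theory Num.Theory.
Import numFieldNormedType.Exports.
Local Open Scope ring_scope.

(** * Dirichlet energy on the hypercube *)

Definition flip (T : finType) (i : T) (B : {set T}) : {set T} :=
  [set j | (j \in B) (+) (j == i)].

Lemma flipK (T : finType) (i : T) : involutive (@flip T i).
Proof. by move=> B; apply/setP => j; rewrite !inE -addbA addbb addbF. Qed.

Lemma flipC (T : finType) (i j : T) B : flip i (flip j B) = flip j (flip i B).
Proof. by apply/setP => k; rewrite !inE addbAC. Qed.

Lemma in_flip (T : finType) (i : T) B : (i \in flip i B) = (i \notin B).
Proof. by rewrite !inE eqxx addbT. Qed.

Lemma flip_in (T : finType) (i : T) (B : {set T}) : i \in B -> flip i B = B :\ i.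
Proof.
move=> iB; apply/setP => j; rewrite !inE.
by case: eqVneq => [->|_]; rewrite ?iB ?addbF.
Qed.

Lemma flip_notin (T : finType) (i : T) (B : {set T}) :
  i \notin B -> flip i B = i |: B.
Proof.
move=> iB; apply/setP => j; rewrite !inE.
by case: eqVneq => [->|_]; rewrite ?(negPf iB) ?addbF.
Qed.

Lemma sum_flip (T : finType) (i : T) (F : {set T} -> R) :
  \sum_B F (flip i B) = \sum_B F B.
Proof. by rewrite [RHS](reindex_inj (can_inj (@flipK T i))). Qed.

(** [flip i] is a bijection from the sets avoiding i to those containing i, so each edge may be
    charged to its lower or to its upper end. *)
Lemma sum_flip_notin (T : finType) (F : T -> {set T} -> R) :
  \sum_(B : {set T}) \sum_(i | i \notin B) F i (flip i B) =
  \sum_(B : {set T}) \sum_(i in B) F i B.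
Proof.
rewrite (exchange_big_dep predT) // [RHS](exchange_big_dep predT) //=.
apply: eq_bigr => i _; rewrite [RHS](reindex_inj (can_inj (@flipK T i))) /=.
by apply: eq_bigl => B; rewrite in_flip.
Qed.

Definition grad (T : finType) (V : {set T} -> R) (i : T) (B : {set T}) : R :=
  V (flip i B) - V B.

Definition energy (T : finType) (V : {set T} -> R) (i : T) : R :=
  \sum_(B : {set T}) grad V i B ^+ 2.

(** Green's identity, with [\sum_i grad V i B] as the Laplacian: (b - a)^2 = - 2 a (b - a) + (b^2 -
    a^2), and the last term sums to 0 because [flip i] permutes the cube. *)
Lemma sum_energy (T : finType) (V : {set T} -> R) :
  \sum_i energy V i = - 2 * \sum_(B : {set T}) V B * \sum_i grad V i B.
Proof.
under [in RHS]eq_bigr => B _ do rewrite mulr_sumr /=.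
rewrite [in RHS]exchange_big /= mulr_sumr /=.
apply: eq_bigr => i _; rewrite /energy.
have := sum_flip i (fun B => V B ^+ 2) =>
  /(congr1 (fun z => z - \sum_(B : {set T}) V B ^+ 2)).
rewrite subrr -sumrB => h0.
rewrite -[RHS]addr0 -[X in _ = _ + X]h0 mulr_sumr -big_split /=.
by apply: eq_bigr => B _; rewrite /grad; ring.
Qed.

Lemma sum_grad (T : finType) (V : {set T} -> R) :
  \sum_(B : {set T}) \sum_i grad V i B = 0.
Proof.
rewrite exchange_big big1 //= => i _.
by rewrite sumrB (sum_flip i V) subrr.
Qed.

(** [energy] meets each edge from both ends, hence the factor 1/2. *)
Lemma sum_up_energy (T : finType) (V : {set T} -> R) :
  \sum_(B : {set T}) \sum_(i | i \notin B) grad V i B ^+ 2 = (\sum_i energy V i) / 2.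
Proof.
have e : \sum_(B : {set T}) \sum_(i | i \notin B) grad V i B ^+ 2 =
         \sum_(B : {set T}) \sum_(i in B) grad V i B ^+ 2.
  rewrite -sum_flip_notin; apply: eq_bigr => B _; apply: eq_bigr => i _.
  by rewrite /grad flipK -sqrrN opprB.
have : \sum_i energy V i = \sum_(B : {set T}) \sum_(i | i \notin B) grad V i B ^+ 2 +
         \sum_(B : {set T}) \sum_(i in B) grad V i B ^+ 2.
  rewrite exchange_big -big_split /=; apply: eq_bigr => B _.
  by rewrite addrC (bigID (mem B)).
by rewrite -e => ->; field.
Qed.

(** * Poincare inequality by averaging over one site at a time *)

Definition site_avg (T : finType) (i : T) (V : {set T} -> R) (B : {set T}) : R :=
  (V B + V (flip i B)) / 2.

Lemma sum_site_avg (T : finType) (i : T) (V : {set T} -> R) :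
  \sum_(B : {set T}) site_avg i V B = \sum_(B : {set T}) V B.
Proof.
rewrite -mulr_suml big_split /= (sum_flip i V); lra.
Qed.

Lemma sum_sqr_site_avg (T : finType) (i : T) (V : {set T} -> R) :
  \sum_(B : {set T}) V B ^+ 2 = \sum_(B : {set T}) site_avg i V B ^+ 2 + energy V i / 4.
Proof.
have h : \sum_(B : {set T}) V B ^+ 2 =
    (\sum_(B : {set T}) V B ^+ 2 + \sum_(B : {set T}) V (flip i B) ^+ 2) / 2.
  rewrite (sum_flip i (fun B => V B ^+ 2)); lra.
rewrite h /energy -big_split /= mulr_suml /= [X in _ + X]mulr_suml -big_split /=.
by apply: eq_bigr => B _; rewrite /site_avg /grad; field.
Qed.

(** The gradient of the average is the mean of two gradients, and squaring is convex. *)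
Lemma energy_site_avg (T : finType) (i j : T) (V : {set T} -> R) :
  energy (site_avg i V) j <= energy V j.
Proof.
have -> : energy V j = (energy V j + \sum_(B : {set T}) grad V j (flip i B) ^+ 2) / 2.
  rewrite (sum_flip i (fun B => grad V j B ^+ 2)) -/(energy V j); lra.
rewrite /energy -big_split mulr_suml /=; apply: ler_sum => B _.
rewrite /site_avg /grad [flip i (flip j B)]flipC.
move: (V _) (V B) (V (flip i B)) (V _) => a b d c.
have := sqr_ge0 (c - b - a + d); nra.
Qed.

Lemma energy_site_avgs (T : finType) (s : seq T) (V : {set T} -> R) j :
  energy (foldr (@site_avg T) V s) j <= energy V j.
Proof. by elim: s => //= i s; apply: le_trans; exact: energy_site_avg. Qed.

Lemma sum_sqr_site_avgs (T : finType) (s : seq T) (V : {set T} -> R) :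
  \sum_(B : {set T}) V B ^+ 2 <=
  \sum_(B : {set T}) foldr (@site_avg T) V s B ^+ 2 + (\sum_(i <- s) energy V i) / 4.
Proof.
elim: s => [|i s IH] /=; first by rewrite big_nil mul0r addr0.
apply: le_trans IH _; rewrite big_cons (sum_sqr_site_avg i).
have := energy_site_avgs s V i; lra.
Qed.

Lemma sum_site_avgs (T : finType) (s : seq T) (V : {set T} -> R) :
  \sum_(B : {set T}) foldr (@site_avg T) V s B = \sum_(B : {set T}) V B.
Proof. by elim: s => //= i s IH; rewrite sum_site_avg. Qed.

Lemma site_avgs_flip (T : finType) (s : seq T) (V : {set T} -> R) i B :
  i \in s -> foldr (@site_avg T) V s (flip i B) = foldr (@site_avg T) V s B.
Proof.
elim: s B => //= j s IH B; rewrite inE /site_avg => /predU1P[<-|/IH is_inv].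
  by rewrite flipK addrC.
by rewrite flipC !is_inv.
Qed.

Lemma flip_invariant_const (T : finType) (V : {set T} -> R) :
  (forall i B, V (flip i B) = V B) -> forall B, V B = V finset.set0.
Proof.
move=> Vflip B; have [m] := ubnP #|B|; elim: m B => // m IH B.
have [->//|/set0Pn[i iB]] := eqVneq B finset.set0.
rewrite (cardsD1 i) iB -(Vflip i) (flip_in iB) ltnS; exact: IH.
Qed.

(* Averaging V over one site loses at most a quarter of the energy of V at that
   site, and after averaging over all sites V has become constant. *)
Lemma cube_poincare (T : finType) (V : {set T} -> R) :
  exists c : R, \sum_(B : {set T}) (V B - c) ^+ 2 <= (\sum_i energy V i) / 4.
Proof.
set W := foldr (@site_avg T) V (enum T).
have Wc : forall B, W B = W finset.set0.
  by apply: flip_invariant_const => i B; rewrite /W site_avgs_flip ?mem_enum.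
exists (W finset.set0); set c := W _.
have sumV : \sum_(B : {set T}) V B = \sum_(B : {set T}) c.
  by rewrite -(sum_site_avgs (enum T)); apply: eq_bigr => B _; exact: Wc.
have sumW : \sum_(B : {set T}) W B ^+ 2 = \sum_(B : {set T}) c ^+ 2.
  by apply: eq_bigr => B _; rewrite Wc.
(* By [sumV], c is the mean of V, so this is the variance identity. *)
have -> : \sum_(B : {set T}) (V B - c) ^+ 2 =
    \sum_(B : {set T}) V B ^+ 2 - \sum_(B : {set T}) W B ^+ 2.
  rewrite sumW -sumrB.
  transitivity (\sum_(B : {set T}) (V B ^+ 2 - c ^+ 2) -
      2 * c * (\sum_(B : {set T}) V B - \sum_(B : {set T}) c)).
    rewrite -sumrB mulr_sumr -sumrB /=; apply: eq_bigr => B _; ring.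
  by rewrite sumV; ring.
rewrite lerBlDl; have := sum_sqr_site_avgs (enum T) V; rewrite big_enum; exact.
Qed.

(** Over S, the squared deviations from c exceed those from the mean a by [#|S|] times (a - c)^2, so
    large sets have averages close to c. *)
Lemma poincare_avg (T : finType) (V : {set T} -> R) (c D : R) (S : {set {set T}}) :
  \sum_(B : {set T}) (V B - c) ^+ 2 <= D ->
  (0 < #|S|)%N ->
  ((\sum_(B in S) V B) / #|S|%:R - c) ^+ 2 <= D / #|S|%:R.
Proof.
move=> VD S0; set s : R := #|S|%:R; have s0 : 0 < s by rewrite ltr0n.
set a := _ / s.
have sumV : \sum_(B in S) V B = s * a by rewrite /a; field; rewrite gt_eqF.
have : \sum_(B in S) (V B - c) ^+ 2 <= D.
  apply: le_trans VD; rewrite [leRHS](bigID (mem S)) /= lerDl.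
  by apply: sumr_ge0 => B _; exact: sqr_ge0.
rewrite ler_pdivlMr // => /(le_trans _); apply; rewrite -subr_ge0.
have -> : \sum_(B in S) (V B - c) ^+ 2 - (a - c) ^+ 2 * s =
  \sum_(B in S) (V B - a) ^+ 2.
  pose k := c ^+ 2 - a ^+ 2.
  have e B : (V B - c) ^+ 2 = (V B - a) ^+ 2 + 2 * (a - c) * V B + k by rewrite /k; ring.
  under eq_bigr => B _ do rewrite e.
  rewrite 2!big_split /= -mulr_sumr sumV sumr_const -[k *+ _]mulr_natl -/s /k; ring.
by apply: sumr_ge0 => B _; exact: sqr_ge0.
Qed.

(** * Levels of the cube and the uniform flow between them *)

Definition level (T : finType) (m : nat) : {set {set T}} := [set B : {set T} | #|B| == m].

Lemma card_level (T : finType) m : #|level T m| = 'C(#|T|, m).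
Proof. by rewrite -card_draws; apply: eq_card => B; rewrite !inE. Qed.

(* The flow from the empty set that spreads uniformly over the edges between
   consecutive levels carries [uflow n j] across each edge from level j to j+1. *)
Definition uflow (n j : nat) : R := ((n - j)%:R * ('C(n, j))%:R)^-1.

(** Summation by parts: inflow and outflow cancel at levels strictly between 0 and m, the source has
    V = 0, and each set of level m receives an equal share of the unit flow. *)
Lemma up_flow (T : finType) (V : {set T} -> R) (m : nat) : (m < #|T|)%N ->
  V finset.set0 = 0 ->
  \sum_(B : {set T}) \sum_(i | i \notin B)
    (if (#|B| < m)%N then uflow #|T| #|B| else 0) * grad V i B
  = (\sum_(B in level T m) V B) / ('C(#|T|, m))%:R.
Proof.
move=> mT V0.
pose th j : R := if (j < m)%N then uflow #|T| j else 0.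
(* In the first sum B is now the upper end of the edge, whose lower end has [#|B|.-1] elements: this
   is inflow minus outflow. *)
have -> : \sum_(B : {set T}) \sum_(i | i \notin B) th #|B| * grad V i B =
  \sum_(B : {set T}) \sum_(i in B) th #|B|.-1 * V B -
  \sum_(B : {set T}) \sum_(i | i \notin B) th #|B| * V B.
  rewrite -(sum_flip_notin (fun _ B => th #|B|.-1 * V B)) -sumrB.
  apply: eq_bigr => B _; rewrite -sumrB; apply: eq_bigr => i iB.
  by rewrite /grad [#|flip i B|](_ : _ = #|B|.+1) ?flip_notin ?cardsU1 ?iB //= mulrBr.
rewrite -sumrB [in RHS]mulr_suml [RHS]big_mkcond /=; apply: eq_bigr => B _.
rewrite !sumr_const -[_ *+ #|B|]mulr_natl -[X in _ - X]mulr_natl.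
have -> : #|[pred i | i \notin B]| = (#|T| - #|B|)%N.
  by rewrite -(cardC (mem B)) addKn; exact: eq_card.
rewrite inE {}/th; have := max_card (mem B); move: #|T| mT => n mn Bn.
(* [uflow_rec] is the total outflow of a set of level j and [uflow_step] the total inflow of a set
   of level j + 1; each is the reciprocal of the level size. *)
have uflow_rec j : (j < n)%N -> (n - j)%:R * uflow n j = ('C(n, j))%:R^-1.
  move=> jn; rewrite /uflow; field.
  by rewrite !pnatr_eq0 -!lt0n bin_gt0 subn_gt0 jn ltnW.
have uflow_step j : (j < n)%N -> j.+1%:R * uflow n j = ('C(n, j.+1))%:R^-1.
  move=> jn; have := mul_bin_left n j => /(congr1 (fun z : nat => z%:R : R)).
  rewrite /uflow -natrM => <-; rewrite natrM; field.
  by rewrite nat1r !pnatr_eq0 -!lt0n bin_gt0 jn.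
have [B0|] := eqVneq #|B| 0%N.
  have -> : B = finset.set0 by apply/eqP; rewrite -cards_eq0 B0.
  by rewrite V0 !mulr0 mul0r subrr; case: ifP.
rewrite -lt0n; case: #|B| Bn => // j jn _ /=.
rewrite !mulrA.
case: (ltngtP j.+1 m) => [jm|mj|jm].
- by rewrite uflow_step // uflow_rec ?subrr // (ltn_trans jm).
- by rewrite !mulr0 !mul0r subrr.
- by rewrite -jm mulr0 mul0r subr0 uflow_step // mulrC.
Qed.

(* Thomson's principle for the flow of [up_flow]. *)
Lemma thomson_up (T : finType) (V : {set T} -> R) (m : nat) (t : R) :
  (m < #|T|)%N -> V finset.set0 = 0 ->
  2 * t * ((\sum_(B in level T m) V B) / ('C(#|T|, m))%:R)
    - t ^+ 2 * (\sum_(j < m) uflow #|T| j) <= (\sum_i energy V i) / 2.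
Proof.
move=> mT V0; rewrite -up_flow // -sum_up_energy.
pose th j : R := if (j < m)%N then uflow #|T| j else 0.
(* The energy of the flow: level j sends (n - j) C(n, j) edges upwards, each carrying the reciprocal
   of that number. *)
have -> : \sum_(j < m) uflow #|T| j =
    \sum_(B : {set T}) \sum_(i | i \notin B) th #|B| ^+ 2.
  transitivity (\sum_(j < m) \sum_(B : {set T} | nat_of_ord j == #|B|)
      (#|T| - j)%:R * uflow #|T| j ^+ 2).
    apply: eq_bigr => j _; have jT := ltn_trans (ltn_ord j) mT.
    rewrite sumr_const (_ : #|_| = 'C(#|T|, j)); last first.
      by rewrite -card_level; apply: eq_card => B; rewrite !inE eq_sym.
    rewrite -[RHS]mulr_natl /uflow; field.
    by rewrite !pnatr_eq0 -!lt0n bin_gt0 subn_gt0 jT ltnW.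
  rewrite (exchange_big_dep predT) //=; apply: eq_bigr => B _.
  rewrite (big_ord1_eq _ (fun j => (#|T| - j)%:R * uflow #|T| j ^+ 2)).
  rewrite sumr_const -[RHS]mulr_natl -[X in _ = X%:R * _](@addKn #|B|).
  by rewrite (cardC (mem B)) /th; case: ifP; rewrite ?expr0n ?mulr0.
rewrite -subr_ge0 !mulr_sumr -!sumrB; apply: sumr_ge0 => B _.
rewrite !mulr_sumr -!sumrB; apply: sumr_ge0 => i _; rewrite -/(th _).
by have := sqr_ge0 (grad V i B - t * th #|B|); congr (0 <= _); ring.
Qed.

(** * Escape from a corner of the hypercube *)

(** In Green's identity [V B] can be replaced by 1 off the empty set, since V = 1 on O and the
    Laplacian vanishes elsewhere. The Laplacian has total 0, so only its value at the empty set
    remains. *)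
Lemma sum_energy_escape (T : finType) (V : {set T} -> R) (O : {set {set T}}) :
  finset.set0 \notin O -> V finset.set0 = 0 -> {in O, forall B, V B = 1} ->
  (forall B, B != finset.set0 -> B \notin O -> \sum_i grad V i B = 0) ->
  \sum_i energy V i = 2 * \sum_i V (flip i finset.set0).
Proof.
move=> O0 V0 V1 Vharm; rewrite sum_energy.
have -> : \sum_(B : {set T}) V B * \sum_i grad V i B =
    \sum_(B : {set T}) \sum_i grad V i B - \sum_i grad V i finset.set0.
  rewrite (bigD1 finset.set0) //= V0 mul0r add0r.
  rewrite [in RHS](bigD1 finset.set0) //= [X in _ = X - _]addrC addrK.
  apply: eq_bigr => B B0; have [BO|BO] := boolP (B \in O); last by rewrite Vharm ?mulr0.
  by rewrite V1 // mul1r.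
rewrite sum_grad add0r mulrN mulNr opprK; congr (_ * _).
by apply: eq_bigr => i _; rewrite /grad V0 subr0.
Qed.

(** * Numerical bounds on the uniform flow and on level 7 *)

Lemma uflow0 n : uflow n 0 = n%:R^-1.
Proof. by rewrite /uflow subn0 bin0 mulr1. Qed.

Lemma uflowS n j : (j.+1 < n)%N ->
  uflow n j.+1 = uflow n j * (j.+1%:R / (n%:R - j.+1%:R)).
Proof.
move=> jn; have := mul_bin_left n j => /(congr1 (fun z : nat => z%:R : R)).
rewrite !natrM /uflow -natrB; last exact: ltnW.
have a0 : (j.+1%:R : R) != 0 by rewrite pnatr_eq0.
have b0 : ((n - j.+1)%:R : R) != 0 by rewrite pnatr_eq0; lia.
have c0 : (('C(n, j.+1))%:R : R) != 0 by rewrite pnatr_eq0 -lt0n bin_gt0; lia.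
move=> <-; field; rewrite ?nat1r; exact/and3P.
Qed.

(** With y = 1/n and q_j = j / (n - j), the left side is 1 + q1 + q1 q2 + ..., which is 1 + y + 3
    y^2 + O(y^3); the coefficient 7/2 leaves room for the error. *)
Lemma sum_uflow7 n : 10 ^+ 3 <= n%:R :> R ->
  n%:R * (\sum_(j < 7) uflow n j) <= 1 + n%:R^-1 + 7 / 2 * n%:R^-1 ^+ 2.
Proof.
move=> n_large; rewrite !big_ord_recr big_ord0 /= add0r.
have n7 : (7 < n)%N by rewrite -(ltr_nat R); lra.
rewrite !uflowS ?uflow0; try lia.
set x : R := n%:R; have x_large : 10 ^+ 3 <= x by [].
have x0 : x != 0 by rewrite gt_eqF //; lra.
set y := x^-1; have xy : x * y = 1 by rewrite mulfV.
have y0 : 0 < y by rewrite invr_gt0; lra.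
have y_small : y <= 1 / 10 ^+ 3.
  by rewrite /y -[leLHS]mul1r ler_pdivrMr; lra.
have q_bound j : (j <= 6)%N -> 0 <= j%:R / (x - j%:R) <= 101 / 100 * j%:R * y.
  rewrite -(ler_nat R) => j6; have j0 : 0 <= j%:R :> R by [].
  rewrite divr_ge0 ?ler_pdivrMr //=; try lra.
  have -> : 101 / 100 * j%:R * y * (x - j%:R) =
    j%:R * (101 / 100) * (x * y - y * j%:R) by ring.
  rewrite xy; nra.
have q1_le : 1 / (x - 1) <= y + 101 / 100 * y ^+ 2.
  rewrite ler_pdivrMr; last lra.
  have -> : (y + 101 / 100 * y ^+ 2) * (x - 1) =
    x * y - y + 101 / 100 * y * (x * y) - 101 / 100 * y ^+ 2 by ring.
  rewrite xy; nra.
have := q_bound 2%N isT; have := q_bound 3%N isT; have := q_bound 4%N isT.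
have := q_bound 5%N isT; have := q_bound 6%N isT; have := q_bound 1%N isT.
move: (1 / _) (2 / _) (3 / _) (4 / _) (5 / _) (6 / _) q1_le => q1 q2 q3 q4 q5 q6 q1_le.
move=> /andP[q1_ge _] /andP[q6_ge q6_le] /andP[q5_ge q5_le] /andP[q4_ge q4_le].
move=> /andP[q3_ge q3_le] /andP[q2_ge q2_le].
have q12 : 0 <= q1 * q2 <= 9 / 4 * y ^+ 2.
  rewrite mulr_ge0 //=.
  apply: le_trans (_ : 11 / 10 * y * (101 / 100 * 2 * y) <= _); last nra.
  apply: ler_pM => //; apply: le_trans q1_le _; nra.
have [q123 q123_ge] : q1 * q2 * q3 <= y ^+ 2 / 40 /\ 0 <= q1 * q2 * q3.
  case/andP: q12 => ? ?; split; last exact: mulr_ge0.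
  apply: le_trans (_ : 9 / 4 * y ^+ 2 * (1 / 100) <= _); last nra.
  apply: ler_pM => //; lra.
have shrink (u q : R) : 0 <= u -> 0 <= q <= 1 -> 0 <= u * q <= u.
  by move=> u0 /andP[q0 q1']; rewrite mulr_ge0 //= ler_piMr.
(* The quotients q4, q5, q6 are at most 1, so the last four products are each at most y^2 / 40. *)
have /andP[? ?] : 0 <= q1 * q2 * q3 * q4 <= q1 * q2 * q3 by apply: shrink => //; lra.
have /andP[? ?] : 0 <= q1 * q2 * q3 * q4 * q5 <= q1 * q2 * q3 * q4.
  by apply: shrink => //; lra.
have /andP[? ?] : 0 <= q1 * q2 * q3 * q4 * q5 * q6 <= q1 * q2 * q3 * q4 * q5.
  by apply: shrink => //; lra.
case/andP: q12 => _ q12_le.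
rewrite (_ : x * _ = x * y * (1 + q1 + q1 * q2 + q1 * q2 * q3 + q1 * q2 * q3 * q4 +
  q1 * q2 * q3 * q4 * q5 + q1 * q2 * q3 * q4 * q5 * q6)); last ring.
rewrite xy mul1r; lra.
Qed.

(** The six factors n - 1, ..., n - 6 are at least 9 n / 10, and 7! / (9/10)^6 < 10^4. *)
Lemma bin7_large n : 10 ^+ 3 <= n%:R :> R -> n%:R ^+ 7 <= 10 ^+ 4 * ('C(n, 7))%:R :> R.
Proof.
move=> n_large; have := bin_ffact n 7; rewrite !ffactnS ffactn0 =>
  /(congr1 (fun z : nat => z%:R : R)).
rewrite !natrM.
have pred_ge k : (k <= 6)%N -> 9 / 10 * n%:R <= (n - k)%:R :> R.
  move=> k6; have k6' : k%:R <= 6 :> R by rewrite (ler_nat _ k 6).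
  have kn : (k <= n)%N by rewrite -(ler_nat R); lra.
  rewrite natrB //; lra.
have := pred_ge 1%N isT; have := pred_ge 2%N isT; have := pred_ge 3%N isT.
have := pred_ge 4%N isT; have := pred_ge 5%N isT; have := pred_ge 6%N isT.
rewrite -!subn1 -!subnDA !addn1 !mulr1.
move: ((n - 1)%:R : R) ((n - 2)%:R : R) ((n - 3)%:R : R) ((n - 4)%:R : R)
  ((n - 5)%:R : R) ((n - 6)%:R : R) => a1 a2 a3 a4 a5 a6 h6 h5 h4 h3 h2 h1 e.
move: e; move: (('C(n, 7))%:R : R) => b e.
move: (n%:R : R) n_large h1 h2 h3 h4 h5 h6 e => x x_large.
have x0 : 0 <= x by clear -x_large; lra.
have : 0 <= 9 / 10 * x by clear -x0; lra.
have : x ^+ 7 = x * (9 / 10 * x) ^+ 6 / (9 / 10) ^+ 6 by field.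
move: (9 / 10 * x) => z x7 z0 h1 h2 h3 h4 h5 h6 e.
have za : z ^+ 6 <= a1 * (a2 * (a3 * (a4 * (a5 * a6)))).
  by rewrite !exprSr expr0 mul1r -!mulrA; do 5 (apply: ler_pM; rewrite ?mulr_ge0 //).
have z6 : 0 <= z ^+ 6 by rewrite exprn_ge0.
have := ler_wpM2l x0 za; have := mulr_ge0 x0 z6; rewrite -e x7.
move: (x * z ^+ 6) => w; clear.
lra.
Qed.

(** The corner is placed at the empty set and [O] stands for the fiber of the maximizer. Both [O]
    and level 7 are large enough for their averages to be close to the same constant c, so level 7
    inherits the value 1 of V on [O]. *)
Lemma cube_escape (T : finType) (V : {set T} -> R) (O : {set {set T}}) (p : R)
    (n := #|T|) :
  10 ^+ 3 <= n%:R :> R -> (n ^ 7 <= #|O|)%N ->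
  finset.set0 \notin O -> (forall i, flip i finset.set0 \notin O) ->
  V finset.set0 = 0 -> {in O, forall B, V B = 1} -> (forall B, V B <= 1) ->
  (forall B, B != finset.set0 -> B \notin O -> \sum_i grad V i B = 0) ->
  \sum_i V (flip i finset.set0) = n%:R * p ->
  0 <= (1 - 1 / n%:R) - p <= 3 / n%:R ^+ 2.
Proof.
move=> n_large O_large O0 O1 V0 V1 V_le1 Vharm npE.
set x : R := n%:R; have x_large : 10 ^+ 3 <= x by [].
have x0 : x != 0 by rewrite gt_eqF //; lra.
set y := x^-1; have xy : x * y = 1 by rewrite mulfV.
have y0 : 0 < y by rewrite invr_gt0; lra.
have y_small : y <= 1 / 10 ^+ 3 by rewrite /y -[leLHS]mul1r ler_pdivrMr; lra.
(* Harmonicity at a singleton: among its n neighbours the empty set has value 0 and the others at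
   most 1. *)
have V_single i : x * V (flip i finset.set0) <= x - 1.
  have := Vharm (flip i finset.set0); rewrite O1 => /(_ _ isT).
  have iB : i \in flip i finset.set0 by rewrite in_flip inE.
  have -> : flip i finset.set0 != finset.set0 by apply/set0Pn; exists i.
  move=> /(_ isT); rewrite sumrB sumr_const -mulr_natl -/n -/x => /eqP.
  rewrite subr_eq0 => /eqP <-.
  rewrite (bigD1 i) //= flipK V0 add0r.
  apply: le_trans (ler_sum (G := fun=> 1) _ _) _ => //.
  rewrite sumr_const cardC1 -/n -subn1 natrB // -(ler_nat R); lra.
have xp_le : x * p <= x - 1.
  rewrite -(ler_pM2l (_ : 0 < x)) -?npE ?mulr_sumr; last lra.
  apply: le_trans (ler_sum (G := fun=> x - 1) _ _) _ => //.
  by rewrite sumr_const -[leLHS]mulr_natl.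
have p_le : p <= 1 - y by rewrite -(ler_pM2l (_ : 0 < x)) ?mulrBr ?xy ?mulr1 //; lra.
rewrite div1r -exprVn -/y.
apply/andP; split; first lra.
have energyE : \sum_i energy V i = 2 * (x * p).
  by rewrite -npE; exact: (@sum_energy_escape _ _ O).
have [c] := cube_poincare V; rewrite energyE => c_le.
have {}c_le : \sum_(B : {set T}) (V B - c) ^+ 2 <= x / 2.
  by apply: le_trans c_le _; lra.
set a := (\sum_(B in level T 7) V B) / ('C(n, 7))%:R.
(* The squared deviation is at most (n/2) / [#|S|] <= 5000 y^6, which is below y^4 / 100 because y
   <= 1/1000. *)
have close (S : {set {set T}}) : n%:R ^+ 7 <= 10 ^+ 4 * #|S|%:R :> R ->
  `|(\sum_(B in S) V B) / #|S|%:R - c| <= y ^+ 2 / 10.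
  move=> S_large; have xS : 0 < #|S|%:R :> R.
    by have x7 : 0 < x ^+ 7; [rewrite exprn_gt0 //; lra | move: S_large; rewrite -/x; lra].
  rewrite -ler_sqr ?nnegrE ?divr_ge0 ?exprn_ge0 ?real_normK ?num_real //; last lra.
  apply: le_trans (poincare_avg c_le _) _; first by rewrite -(ltr_nat R).
  rewrite ler_pdivrMr //.
  have k0 : 0 <= (y ^+ 2 / 10) ^+ 2 / 10 ^+ 4 by rewrite divr_ge0 ?sqr_ge0 ?exprn_ge0.
  have := ler_wpM2l k0 S_large; rewrite -/x.
  have -> : (y ^+ 2 / 10) ^+ 2 / 10 ^+ 4 * x ^+ 7 =
    x ^+ 3 * (x * y) ^+ 4 / 10 ^+ 6 by field.
  rewrite xy expr1n mulr1; move: (y ^+ 2 / 10) x_large (#|S|%:R : R); clear.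
  move=> z x_large s h.
  have : 10 ^+ 3 * x <= x * x by rewrite ler_wpM2r //; lra.
  have x3 : x * (10 ^+ 3 * 10 ^+ 3) <= x * (x * x).
    by apply: ler_wpM2l; [lra | apply: ler_pM; lra].
  move=> _; move: h; rewrite !exprS !expr0 !mulr1; lra.
have a_close : `|a - c| <= y ^+ 2 / 10.
  have := close (level T 7); rewrite card_level; apply; exact: bin7_large.
have c_close : `|1 - c| <= y ^+ 2 / 10.
  have O_avg : (\sum_(B in O) V B) / #|O|%:R = 1.
    rewrite (eq_bigr (fun=> 1)) ?sumr_const ?divff // pnatr_eq0 -lt0n.
    by apply: leq_trans O_large; rewrite expn_gt0 -(ltr_nat R) -/n -/x; lra.
  have := close O; rewrite O_avg; apply; move: O_large; rewrite -(ler_nat R) natrX => h.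
  by apply: le_trans h _; rewrite ler_peMl //; lra.
have a_ge : 1 - y ^+ 2 / 5 <= a.
  move: a_close c_close; rewrite !ler_norml => /andP[? ?] /andP[? ?]; lra.
have n7 : (7 < n)%N by rewrite -(ltr_nat R) -/x; lra.
(* The best flow strength is a / s, with s the sum of the [uflow]. The choice x (1 - y) has relative
   error O(y^2), which costs only O(y^4). *)
have := thomson_up (x * (1 - y)) n7 V0; rewrite -/n energyE -/a.
have := sum_uflow7 n_large; rewrite -/x -/y.
move: (\sum_(j < 7) _) => s s_le thomson.
have p_ge : 2 * (1 - y) * a - (1 - y) ^+ 2 * (x * s) <= p.
  by rewrite -(ler_pM2l (_ : 0 < x)); [move: thomson; congr (_ <= _); field | lra].
have := ler_wpM2l (_ : 0 <= (1 - y) ^+ 2) s_le; rewrite sqr_ge0 => /(_ isT) s_le'.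
have := ler_wpM2l (_ : 0 <= 1 - y) a_ge; rewrite subr_ge0 => /(_ _) a_ge'.
have {}a_ge' := a_ge' ltac:(lra).
have y2 : 0 <= y ^+ 2 by exact: sqr_ge0.
have y3 : 0 <= y ^+ 3 by rewrite exprn_ge0 // ltW.
have y43 : y ^+ 4 <= y ^+ 3 by rewrite exprSr ler_piMr //; lra.
move: p_ge s_le' a_ge' y2 y3 y43; clear; move: (x * s) => r *.
(* Expanding gives p >= 1 - y - 29/10 y^2 + 32/5 y^3 - 7/2 y^4, and y^4 <= y^3. *)
nra.
Qed.

(** * The lumping map *)

Definition class (N d : nat) (lam : 'I_N -> 'I_d) (k : 'I_d) : {set 'I_N} :=
  finset.finset (fun i => lam i == k).

Lemma in_class (N d : nat) (lam : 'I_N -> 'I_d) k i : (i \in class lam k) = (lam i == k).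
Proof. by rewrite inE. Qed.

Lemma card_class (N d : nat) (lam : 'I_N -> 'I_d) k : #|class lam k| = csize lam k.
Proof. by []. Qed.

Definition count_in (N d : nat) (lam : 'I_N -> 'I_d) (A : {set 'I_N}) (k : 'I_d) : nat :=
  #|A :&: class lam k|.

Lemma count_in_le (N d : nat) (lam : 'I_N -> 'I_d) A k :
  (count_in lam A k <= csize lam k)%N.
Proof. by rewrite -card_class subset_leq_card // finset.subsetIr. Qed.

Lemma count_in_leN (N d : nat) (lam : 'I_N -> 'I_d) A k : (count_in lam A k <= N)%N.
Proof. by rewrite -[leqRHS]card_ord max_card. Qed.

Lemma lump_subproof (N d : nat) (lam : 'I_N -> 'I_d) (A : {set 'I_N}) :
  [forall k, (([ffun k => inord (count_in lam A k)] : {ffun 'I_d -> 'I_N.+1}) k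
    <= csize lam k)%N].
Proof.
by apply/forallP => k; rewrite ffunE inordK ?ltnS ?count_in_leN // count_in_le.
Qed.

Definition lump (N d : nat) (lam : 'I_N -> 'I_d) (A : {set 'I_N}) : state lam :=
  exist (fun n : {ffun 'I_d -> 'I_N.+1} => [forall k, ((n k : nat) <= csize lam k)%N])
    [ffun k => inord (count_in lam A k)] (lump_subproof lam A).

Lemma lumpE (N d : nat) (lam : 'I_N -> 'I_d) A k :
  sval (lump lam A) k = count_in lam A k :> nat.
Proof. by rewrite /= ffunE inordK // ltnS count_in_leN. Qed.

Lemma state_eqP (N d : nat) (lam : 'I_N -> 'I_d) (y z : state lam) :
  reflect (forall k, sval y k = sval z k :> nat) (y == z).
Proof.
apply: (iffP eqP) => [->//|yz]; apply: val_inj; apply/ffunP => k.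
by apply: val_inj; exact: yz.
Qed.

Lemma count_in_flip (N d : nat) (lam : 'I_N -> 'I_d) (A : {set 'I_N}) i k :
  i \notin A -> count_in lam (flip i A) k = ((lam i == k) + count_in lam A k)%N.
Proof.
move=> iA; rewrite flip_notin // /count_in finset.setIUl.
have [ik|ik] := boolP (lam i == k).
  rewrite (finset.setIidPl _) ?finset.sub1set ?in_class // cardsU1.
  by rewrite finset.in_setI (negPf iA).
rewrite (_ : finset.set1 i :&: class lam k = finset.set0) ?finset.set0U //.
apply/eqP; rewrite finset.setI_eq0 finset.disjoints1 in_class //.
Qed.

Lemma csize_gt0 (N d : nat) (lam : 'I_N -> 'I_d) k :
  is_dpartition lam -> (0 < csize lam k)%N.
Proof.
move=> /(_ k)[i ik]; rewrite -card_class.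
by apply/card_gt0P; exists i; rewrite in_class ik.
Qed.

(** [gcoord] is affine in the count with slope 2 / |Lambda_k|, so a move of the chain changes one
    count by s. *)
Lemma gcoord_stepE (N d : nat) (lam : 'I_N -> 'I_d) (y z : state lam) k (s : R) :
  is_dpartition lam ->
  [forall j, gcoord z j == gcoord y j +
     (if j == k then s * 2 / (csize lam k)%:R else 0)] =
  [forall j, (sval z j)%:R == (sval y j)%:R + (if j == k then s else 0) :> R].
Proof.
move=> lamP; apply: eq_forallb => j; rewrite /gcoord.
have c0 l : (csize lam l)%:R != 0 :> R by rewrite pnatr_eq0 -lt0n csize_gt0.
rewrite !natrM -subr_eq0 -[RHS]subr_eq0; case: (eqVneq j k) => [->|jk].
  rewrite (_ : _ - _ = ((sval z k)%:R - ((sval y k)%:R + s)) * (2 / (csize lam k)%:R)).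
    by rewrite mulf_eq0 (negPf (_ : 2 / _ != 0)) ?orbF // mulf_neq0 ?invr_eq0.
  by field.
rewrite (_ : _ - _ = ((sval z j)%:R - ((sval y j)%:R + 0)) * (2 / (csize lam j)%:R)).
  by rewrite mulf_eq0 (negPf (_ : 2 / _ != 0)) ?orbF // mulf_neq0 ?invr_eq0.
by field.
Qed.

Lemma lump_flip_notin (N d : nat) (lam : 'I_N -> 'I_d) (A : {set 'I_N}) i
    (z : state lam) :
  is_dpartition lam -> i \notin A ->
  [forall j, gcoord z j == gcoord (lump lam A) j +
     (if j == lam i then 1 * 2 / (csize lam (lam i))%:R else 0)] =
  (lump lam (flip i A) == z).
Proof.
move=> lamP iA; rewrite gcoord_stepE //; apply/forallP/state_eqP => h j.
  have := h j; rewrite !lumpE count_in_flip // [_ == j]eq_sym.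
  by case: (eqVneq j (lam i)) => _; rewrite ?addr0 ?natr1 eqr_nat => /eqP ->; lia.
have := h j; rewrite !lumpE count_in_flip // [_ == j]eq_sym => <-.
by case: (eqVneq j (lam i)) => _; rewrite ?addr0 ?natr1 eqr_nat; lia.
Qed.

Lemma lump_flip_in (N d : nat) (lam : 'I_N -> 'I_d) (A : {set 'I_N}) i (z : state lam) :
  is_dpartition lam -> i \in A ->
  [forall j, gcoord z j == gcoord (lump lam A) j +
     (if j == lam i then -1 * 2 / (csize lam (lam i))%:R else 0)] =
  (lump lam (flip i A) == z).
Proof.
move=> lamP iA; have iA' : i \notin flip i A by rewrite in_flip negbK.
have cntA j := count_in_flip lam j iA'; rewrite flipK in cntA.
rewrite gcoord_stepE //; apply/forallP/state_eqP => h j.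
  have := h j; rewrite !lumpE cntA [_ == j]eq_sym.
  case: (eqVneq j (lam i)) => _; last by rewrite addr0 eqr_nat => /eqP ->.
  by rewrite add1n -natr1 addrK eqr_nat => /eqP ->.
have := h j; rewrite !lumpE cntA [_ == j]eq_sym => <-.
by case: (eqVneq j (lam i)) => _; rewrite ?addr0 // add1n -natr1 addrK.
Qed.

(** Lumpability: |Lambda_k| (1 - s x_k) / 2 counts the sites of class k with spin -s, those whose
    flip moves the k-th coordinate in direction s. *)
Lemma rN_lump (N d : nat) (lam : 'I_N -> 'I_d) (A : {set 'I_N}) (z : state lam) :
  is_dpartition lam ->
  rN (lump lam A) z = \sum_i (if lump lam (flip i A) == z then N%:R^-1 else 0).
Proof.
move=> lamP; rewrite (partition_big lam predT) //=.
apply: eq_bigr => k _; rewrite !big_cons big_nil addr0.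
rewrite (bigID (mem A)) [X in _ = X]addrC /=.
have cardA : #|[pred i | (lam i == k) && (i \in A)]| = count_in lam A k.
  by apply: eq_card => i; rewrite !inE andbC.
have cardAC : #|[pred i | (lam i == k) && (i \notin A)]| =
    (csize lam k - count_in lam A k)%N.
  rewrite -card_class -(cardsID A (class lam k)) finset.setIC addKn.
  by apply: eq_card => i; rewrite !inE andbC.
have c0 : (csize lam k)%:R != 0 :> R by rewrite pnatr_eq0 -lt0n csize_gt0.
have n0 : N%:R != 0 :> R.
  rewrite pnatr_eq0 -lt0n -(card_ord N); have /card_gt0P[i _] := csize_gt0 k lamP.
  by apply/card_gt0P; exists i.
congr (_ + _).
  rewrite [RHS](eq_bigr (fun=> if [forall j, gcoord z j == gcoord (lump lam A) j +
     (if j == k then 1 * 2 / (csize lam k)%:R else 0)] then N%:R^-1 else 0)); last first.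
    by move=> i /andP[/eqP <- iA]; rewrite lump_flip_notin.
  case: ifP => _; last by rewrite big1.
  rewrite sumr_const cardAC -[_ *+ (_ - _)]mulr_natl natrB ?count_in_le //.
  rewrite /gcoord lumpE natrM.
  by field; rewrite c0 n0.
rewrite [RHS](eq_bigr (fun=> if [forall j, gcoord z j == gcoord (lump lam A) j +
   (if j == k then -1 * 2 / (csize lam k)%:R else 0)] then N%:R^-1 else 0)); last first.
  by move=> i /andP[/eqP <- iA]; rewrite lump_flip_in.
case: ifP => _; last by rewrite big1.
rewrite sumr_const cardA -[_ *+ count_in _ _ _]mulr_natl /gcoord lumpE natrM.
by field; rewrite c0 n0.
Qed.

Lemma rN_step (N d : nat) (lam : 'I_N -> 'I_d) (A : {set 'I_N}) (f : state lam -> R) :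
  is_dpartition lam ->
  \sum_z rN (lump lam A) z * f z = (\sum_i f (lump lam (flip i A))) / N%:R.
Proof.
move=> lamP; under eq_bigr => z _ do rewrite rN_lump // mulr_suml.
rewrite exchange_big /= mulr_suml; apply: eq_bigr => i _.
rewrite (bigD1 (lump lam (flip i A))) //= eqxx big1 => [|z]; first by rewrite addr0 mulrC.
by rewrite eq_sym => /negPf ->; rewrite mul0r.
Qed.

(* The configuration whose set of disagreements with the corner [x] is [B];
   [xs k] says whether [x] is +1 on the class [k]. *)
Definition twist (N d : nat) (lam : 'I_N -> 'I_d) (xs : pred 'I_d)
  (B : {set 'I_N}) : {set 'I_N} :=
  finset.finset (fun i => (i \in B) (+) xs (lam i)).

Lemma flip_twist (N d : nat) (lam : 'I_N -> 'I_d) (xs : pred 'I_d) i B :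
  flip i (twist lam xs B) = twist lam xs (flip i B).
Proof. by apply/setP => j; rewrite !inE addbAC. Qed.

Lemma count_in_twist (N d : nat) (lam : 'I_N -> 'I_d) (xs : pred 'I_d) B k :
  count_in lam (twist lam xs B) k =
  if xs k then (csize lam k - count_in lam B k)%N else count_in lam B k.
Proof.
case: ifP => xk.
  rewrite -card_class -(cardsID B (class lam k)) finset.setIC addKn.
  apply: eq_card => i; rewrite !inE.
  by case: eqP => [->|]; rewrite ?andbF // xk addbT andbT.
by apply: eq_card => i; rewrite !inE; case: eqP => [->|]; rewrite ?andbF // xk addbF.
Qed.

Lemma card_count_in (N d : nat) (lam : 'I_N -> 'I_d) (B : {set 'I_N}) :
  #|B| = (\sum_k count_in lam B k)%N.
Proof.
rewrite -sum1_card (partition_big lam predT) //=; apply: eq_bigr => k _.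
by rewrite /count_in -sum1_card; apply: eq_bigl => i; rewrite !inE.
Qed.

(** The lumped state determines the class counts of B, so each fiber lies in one level around the
    corner; in particular the corner is alone in its fiber. *)
Lemma card_lump_twist (N d : nat) (lam : 'I_N -> 'I_d) (xs : pred 'I_d) B B' :
  lump lam (twist lam xs B) = lump lam (twist lam xs B') -> #|B| = #|B'|.
Proof.
move=> e; rewrite !(card_count_in lam); apply: eq_bigr => k _.
have := congr1 (fun y : state lam => sval y k : nat) e; rewrite !lumpE !count_in_twist.
by case: ifP => // _; have := count_in_le lam B k; have := count_in_le lam B' k; lia.
Qed.

(** * Hitting probabilities pulled back to the cube *)

Definition lift_hitb (N d : nat) (lam : 'I_N -> 'I_d) (o x : state lam) (t : nat)
  (A : {set 'I_N}) : R := hitb (@rN N d lam) (pred1 o) (pred1 x) t (lump lam A).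

Lemma lift_hitbS (N d : nat) (lam : 'I_N -> 'I_d) (o x : state lam) t A :
  is_dpartition lam ->
  lift_hitb o x t.+1 A = if lump lam A == o then 1 else if lump lam A == x then 0
    else (\sum_i lift_hitb o x t (flip i A)) / N%:R.
Proof. by move=> lamP; rewrite /lift_hitb /= rN_step. Qed.

Lemma lift_hitb_bounds (N d : nat) (lam : 'I_N -> 'I_d) (o x : state lam) t A :
  is_dpartition lam -> 0 <= lift_hitb o x t A <= 1.
Proof.
move=> lamP; elim: t A => [|t IH] A.
  by rewrite /lift_hitb /=; case: ifP; rewrite lexx ler01.
rewrite lift_hitbS //; do 2 (case: ifP => _; first by rewrite lexx ler01).
apply/andP; split.
  by rewrite divr_ge0 // sumr_ge0 // => i _; have /andP[] := IH (flip i A).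
(* For N = 0 the quotient is 0 by convention. *)
have [N0|N0] := posnP N; first by rewrite [X in _ / X%:R]N0 invr0 mulr0 ler01.
rewrite ler_pdivrMr ?ltr0n // mul1r.
apply: le_trans (ler_sum (G := fun=> 1) _ _) _ => [i _|].
  by have /andP[] := IH (flip i A).
by rewrite sumr_const card_ord.
Qed.

(** Together with the bound by 1, this makes [lift_hit] a true limit rather than a default value of
    [limn]. *)
Lemma lift_hitb_homo (N d : nat) (lam : 'I_N -> 'I_d) (o x : state lam) A :
  is_dpartition lam ->
  {homo (fun t => lift_hitb o x t A) : s t / (s <= t)%N >-> s <= t}.
Proof.
move=> lamP; apply: homo_leq => [//|? ? ?|t]; first exact: le_trans.
elim: t A => [|t IH] A.
  rewrite {1}/lift_hitb /=; case: eqP => [e|_]; last first.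
    by have /andP[] := lift_hitb_bounds o x 1 A lamP.
  by rewrite lift_hitbS // e eqxx.
rewrite !lift_hitbS //; do 2 (case: ifP => // _).
by rewrite ler_wpM2r ?invr_ge0 // ler_sum.
Qed.

Definition lift_hit (N d : nat) (lam : 'I_N -> 'I_d) (o x : state lam)
  (A : {set 'I_N}) : R :=
  limn (fun t => lift_hitb o x t A).

Lemma cvg_lift_hitb (N d : nat) (lam : 'I_N -> 'I_d) (o x : state lam) A :
  is_dpartition lam ->
  ((fun t => lift_hitb o x t A) @ \oo --> lift_hit o x A)%classic.
Proof.
move=> lamP; apply: nondecreasing_is_cvgn; first exact: lift_hitb_homo.
by exists 1 => _ [t _ <-]; have /andP[] := lift_hitb_bounds o x t A lamP.
Qed.

(* For an abstract [realType]: the topological additive structure needed by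
   [cvg_big] is not inferred on the concrete reals. *)
Lemma cvg_sum (K : realType) (I : Type) (s : seq I) (f : I -> nat -> K) (l : I -> K) :
  (forall i, f i n @[n --> \oo] --> l i)%classic ->
  (\sum_(i <- s) f i n @[n --> \oo] --> \sum_(i <- s) l i)%classic.
Proof. by move=> fl; apply: cvg_big => [|i _]; [exact: add_continuous | exact: fl]. Qed.

Lemma cvg_lift_step (N d : nat) (lam : 'I_N -> 'I_d) (o x : state lam) A :
  is_dpartition lam ->
  ((fun t => (\sum_i lift_hitb o x t (flip i A)) / N%:R) @ \oo -->
    (\sum_i lift_hit o x (flip i A)) / N%:R)%classic.
Proof.
move=> lamP; apply: cvgMr_tmp.
apply: cvg_sum => i; exact: cvg_lift_hitb.
Qed.

Lemma lift_hit_le1 (N d : nat) (lam : 'I_N -> 'I_d) (o x : state lam) A :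
  is_dpartition lam -> lift_hit o x A <= 1.
Proof.
move=> lamP; apply: limr_le; first exact: cvg_lift_hitb.
by near=> t; have /andP[] := lift_hitb_bounds o x t A lamP.
Unshelve. all: by end_near. Qed.

(** Letting t tend to infinity in [lift_hitbS], after a shift of the time index, gives harmonicity
    off [o] and [x]. *)
Lemma lift_hitE (N d : nat) (lam : 'I_N -> 'I_d) (o x : state lam) A :
  is_dpartition lam ->
  lift_hit o x A = if lump lam A == o then 1 else if lump lam A == x then 0
    else (\sum_i lift_hit o x (flip i A)) / N%:R.
Proof.
move=> lamP; have := @cvg_lift_hitb _ _ _ o x A lamP; rewrite -cvg_shiftS.
under eq_fun => t do rewrite lift_hitbS //.
have uniq (l : R) (u : nat -> R) : (u @ \oo --> l -> u @ \oo --> lift_hit o x A ->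
  lift_hit o x A = l)%classic.
  by move=> ul uh; apply: (cvg_unique (@Rhausdorff R) uh ul).
case: ifP => _; first exact: uniq (cvg_cst _).
case: ifP => _; first exact: uniq (cvg_cst _).
exact: uniq (@cvg_lift_step _ _ _ o x A lamP).
Qed.

(** [hit_before] makes the first step separately, so a start at [x] does not count as a return and
    [lift_hit] enters only at the neighbours. *)
Lemma hit_beforeE (N d : nat) (lam : 'I_N -> 'I_d) (o x : state lam) A :
  is_dpartition lam ->
  hit_before (@rN N d lam) (pred1 o) (pred1 x) (lump lam A) =
  (\sum_i lift_hit o x (flip i A)) / N%:R.
Proof.
move=> lamP; rewrite /hit_before; under eq_fun => t do rewrite rN_step //.
apply: (cvg_lim (@Rhausdorff R)); exact: (@cvg_lift_step _ _ _ o x A lamP).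
Qed.

(** * Fibers of the lumping map *)

Definition fiber (N d : nat) (lam : 'I_N -> 'I_d) (y : state lam) : {set {set 'I_N}} :=
  finset.finset (fun A => lump lam A == y).

Definition traces (N d : nat) (lam : 'I_N -> 'I_d)
  (A : {set 'I_N}) : {ffun 'I_d -> {set 'I_N}} :=
  [ffun k => A :&: class lam k].

Lemma traces_inj (N d : nat) (lam : 'I_N -> 'I_d) : injective (traces lam).
Proof.
move=> A B /ffunP AB; apply/setP => i; have /setP/(_ i) := AB (lam i).
by rewrite !ffunE !inE eqxx !andbT.
Qed.

(** A configuration of the fiber amounts to an independent choice, in each class, of a trace of the
    prescribed size. *)
Lemma card_fiber (N d : nat) (lam : 'I_N -> 'I_d) (y : state lam) :
  #|fiber y| = (\prod_k 'C(csize lam k, sval y k))%N.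
Proof.
pose Q k : pred {set 'I_N} := fun B => (B \subset class lam k) && (#|B| == sval y k).
transitivity (\prod_k \sum_(B | Q k B) 1)%N; last first.
  apply: eq_bigr => k _; rewrite -card_class -cards_draws -sum1_card.
  by apply: eq_bigl => B; rewrite inE.
rewrite bigA_distr_big_dep /= -(card_imset _ (@traces_inj N d lam)) -sum1_card.
rewrite [RHS](eq_bigr (fun=> 1%N)) => [|f _]; last by rewrite big1.
apply: eq_bigl => f; apply/imsetP/familyP => [[A + ->] k|f_fam].
  rewrite inE => /state_eqP/(_ k); rewrite lumpE => Ak.
  by rewrite ffunE unfold_in /Q finset.subsetIr -Ak eqxx.
pose A := \bigcup_k f k.
have traceA k : A :&: class lam k = f k.
  apply/setP => i; rewrite !inE; apply/andP/idP => [[/bigcupP[l _ il] /eqP ik]|ik].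
    have /andP[/fintype.subsetP/(_ i il)] := f_fam l.
    by rewrite in_class ik => /eqP ->.
  have /andP[/fintype.subsetP/(_ i ik)] := f_fam k; rewrite in_class => -> _; split=> //.
  by apply/bigcupP; exists k.
exists A; last by apply/ffunP => k; rewrite ffunE traceA.
rewrite inE; apply/state_eqP => k; rewrite lumpE /count_in traceA.
by have /andP[_ /eqP] := f_fam k.
Qed.

(** [QN y] is 2^-N times the size of the fiber of y. *)
Lemma fiber_max (N d : nat) (lam : 'I_N -> 'I_d) (o y : state lam) :
  (forall z : state lam, QN z <= QN o) -> (#|fiber y| <= #|fiber o|)%N.
Proof.
move=> /(_ y); rewrite /QN ler_pM2l ?invr_gt0 ?exprn_gt0 // -!natr_prod ler_nat.
by rewrite !card_fiber.
Qed.

Lemma card_state_le (N d : nat) (lam : 'I_N -> 'I_d) : (#|{: state lam}| <= N.+1 ^ d)%N.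
Proof.
by rewrite card_sig (leq_trans (max_card _)) // card_ffun !card_ord.
Qed.

(** Pigeonhole: the cube is covered by at most (N+1)^d fibers, none larger than that of [o]. *)
Lemma card_cube_le (N d : nat) (lam : 'I_N -> 'I_d) (o : state lam) :
  (forall z : state lam, QN z <= QN o) -> (2 ^ N <= N.+1 ^ d * #|fiber o|)%N.
Proof.
move=> o_max; rewrite -[N in (2 ^ N)%N]card_ord -cardsT -card_powerset finset.powersetT.
rewrite -sum1_card (partition_big (lump lam) predT) //=.
apply: leq_trans (leq_mul (card_state_le lam) (leqnn _)).
rewrite -sum_nat_const; apply: leq_sum => y _.
apply: leq_trans (fiber_max y o_max); rewrite sum1_card.
by apply/eq_leq/eq_card => A; rewrite unfold_in /= finset.in_setT inE.
Qed.

(** * From the bound on d to the size of the largest fiber *)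

Lemma ln2_ge : 1 / 2 <= ln 2 :> R.
Proof.
rewrite -ler_expR lnK ?posrE //.
have := expR_ge1Dx (- (1 / 2) : R); rewrite expRN.
have -> : 1 - 1 / 2 = 2^-1 :> R by field.
by rewrite lef_pV2 // posrE ?expR_gt0.
Qed.

(** Since (N+1)^d <= N^(2d), it suffices that (7 + 2d) ln N <= N ln 2. As d >= 1 and d ln N <= N /
    10^4, the left side is at most 9 N / 10^4, while ln 2 >= 1/2. The same bound with ln N >= 1/2
    gives N >= 5000. *)
Lemma fiber_large (N d : nat) (lam : 'I_N -> 'I_d) (o : state lam) :
  (0 < N)%N -> d%:R <= 1 / 10 ^+ 4 * (N%:R / ln N%:R) :> R ->
  (forall z : state lam, QN z <= QN o) ->
  10 ^+ 3 <= N%:R :> R /\ (N ^ 7 <= #|fiber o|)%N.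
Proof.
move=> N0 dN o_max.
have d1 : 1 <= d%:R :> R.
  by rewrite ler1n (leq_ltn_trans (leq0n (lam (Ordinal N0)))).
(* At N = 1 the bound on d reads d <= 0, as ln 1 = 0 and the inverse of 0 is 0. *)
have N2 : (1 < N)%N.
  rewrite ltn_neqAle N0 andbT; apply/eqP => N1.
  by move: dN; rewrite -[X in ln X%:R]N1 ln1 invr0 !mulr0; lra.
have lnN_ge : ln 2 <= ln N%:R :> R by rewrite ler_ln ?posrE ?ltr0n // ler_nat.
have ln2 := ln2_ge.
have lnN0 : 0 < ln N%:R :> R by lra.
have d_lnN : 10 ^+ 4 * (d%:R * ln N%:R) <= N%:R :> R.
  move: dN; rewrite mulrA ler_pdivlMr //; lra.
have N_large : 10 ^+ 3 <= N%:R :> R.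
  have : 1 * (1 / 2) <= d%:R * ln N%:R :> R by apply: ler_pM => //; lra.
  by lra.
split=> //.
have pow_le : (N ^ 7 * N.+1 ^ d <= 2 ^ N)%N.
  have NN : (N.+1 <= N ^ 2)%N by rewrite -mulnn; nia.
  apply: (@leq_trans (N ^ (7 + 2 * d))).
    by rewrite expnD expnM leq_mul2l leq_exp2r ?NN ?orbT // -(ler1n R).
  rewrite -(ler_nat R) !natrX -ler_ln ?posrE ?exprn_gt0 ?ltr0n //.
  rewrite !lnXn ?ltr0n // -[X in X <= _]mulr_natl -[X in _ <= X]mulr_natl natrD natrM.
  have : 0 <= ln N%:R * (d%:R - 1) :> R by apply: mulr_ge0; lra.
  have : 0 <= N%:R * (ln 2 - 1 / 2) :> R by apply: mulr_ge0; lra.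
  nra.
rewrite -(leq_pmul2r (_ : 0 < N.+1 ^ d)%N) ?expn_gt0 //.
by apply: leq_trans pow_le _; rewrite mulnC card_cube_le.
Qed.

(** * The corner as a configuration, and the escape bound for the lumped chain *)

Lemma lump_corner (N d : nat) (lam : 'I_N -> 'I_d) (x : state lam) :
  is_dpartition lam -> (forall k, gcoord x k = 1 \/ gcoord x k = -1) ->
  lump lam (twist lam (fun k => gcoord x k == 1) finset.set0) = x.
Proof.
move=> lamP x_corner; apply/eqP/state_eqP => k.
rewrite lumpE count_in_twist /count_in finset.set0I cards0 subn0.
have c0 : (csize lam k)%:R != 0 :> R by rewrite pnatr_eq0 -lt0n csize_gt0.
have sval_k : (2 * sval x k)%:R = (gcoord x k + 1) * (csize lam k)%:R :> R.
  by rewrite /gcoord; field.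
case: eqP sval_k => [-> |ne]; last first.
  have [//|->] := x_corner k; rewrite addNr mul0r => /eqP.
  by rewrite pnatr_eq0 muln_eq0 /= => /eqP.
by rewrite -[1 + 1]/(2%:R) -natrM => /eqP; rewrite eqr_nat eqn_pmul2l // => /eqP.
Qed.

Theorem theorem3p1 :
  exists alpha0 C : R, 0 < alpha0 /\ alpha0 <= 1 / 20%:R /\
  forall (N d : nat) (lam : 'I_N -> 'I_d),
    (0 < N)%N ->
    is_dpartition lam ->
    d%:R <= alpha0 * (N%:R / ln N%:R) ->
    forall (o x : state lam),
      (forall y : state lam, QN y <= QN o) ->
      (forall k, gcoord x k = 1 \/ gcoord x k = -1) ->
      let p := hit_before (@rN N d lam) (pred1 o) (pred1 x) x in
      0 <= (1 - 1 / N%:R) - p /\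
      (1 - 1 / N%:R) - p <= 3%:R / N%:R ^+ 2 * (1 + C / Num.sqrt N%:R).
Proof.
(* The first witness is the constant of [fiber_large]; C = 0 suffices because [cube_escape] has no
   error term. *)
exists (1 / 10 ^+ 4), 0; split; first by lra.
split; first by lra.
move=> N d lam N0 lamP dN o x o_max x_corner p.
have [N_large fiber_o] := fiber_large N0 dN o_max.
have N1 : (1 < N)%N by rewrite -(ltr_nat R); lra.
set xs : pred 'I_d := fun k => gcoord x k == 1.
have x_def : lump lam (twist lam xs finset.set0) = x by exact: lump_corner.
pose V B := lift_hit o x (twist lam xs B).
pose O : {set {set 'I_N}} := finset.finset (fun B => lump lam (twist lam xs B) == o).
have twistK : involutive (twist lam xs).
  by move=> B; apply/setP => i; rewrite !inE -addbA addbb addbF.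
have card_O : #|O| = #|fiber o|.
  rewrite -(card_imset _ (can_inj twistK)); apply: eq_card => A; rewrite inE.
  apply/imsetP/idP => [[B + ->]|Ao]; first by rewrite inE.
  by exists (twist lam xs A); rewrite ?twistK // inE twistK.
have O_large : (N ^ 7 <= #|O|)%N by rewrite card_O.
(* By [card_lump_twist] all of [O] would lie in the level of B, which has at most N elements,
   against N^7 <= [#|O|]. *)
have O_low (B : {set 'I_N}) : (#|B| <= 1)%N -> B \notin O.
  move=> B1; apply/negP; rewrite inE => /eqP Bo.
  have : (#|O| <= N)%N.
    apply: (@leq_trans 'C(N, #|B|)); last first.
      by case: #|B| B1 => [|[|]] //; rewrite ?bin0 ?bin1 // ltnW.
    rewrite -[N in 'C(N, _)]card_ord -card_level subset_leq_card //.
    apply/fintype.subsetP => B'; rewrite !inE => /eqP B'o.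
    by apply/eqP/(@card_lump_twist _ _ lam xs); rewrite Bo.
  apply/negP; rewrite -ltnNge; apply: leq_trans O_large.
  by rewrite -[X in (X < _)%N]expn1 ltn_exp2l.
have O0 : finset.set0 \notin O by rewrite O_low // cards0.
have xo : x != o by move: O0; rewrite inE x_def.
have n0 : N%:R != 0 :> R by rewrite pnatr_eq0 -lt0n.
have pE : \sum_i V (flip i finset.set0) = N%:R * p.
  rewrite /p -[X in hit_before _ _ _ X]x_def hit_beforeE // mulrC mulfVK //.
  by apply: eq_bigr => i _; rewrite /V flip_twist.
have := @cube_escape _ V O p; rewrite card_ord => /(_ N_large O_large O0).
case/(_ _ _ _ _ _ pE)/andP.
- by move=> i; apply: O_low; rewrite flip_notin ?inE // cardsU1 cards0 inE.
- by rewrite /V lift_hitE // x_def (negPf xo) eqxx.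
- by move=> B; rewrite inE /V lift_hitE // => ->.
- by move=> B; exact: lift_hit_le1.
- move=> B B0 BO; rewrite /grad sumrB sumr_const card_ord.
  rewrite {2}/V lift_hitE //; move: (BO); rewrite inE => /negPf ->.
  (* A set lumped to [x] would have as many elements as the empty set, so V is harmonic at B. *)
  rewrite ifF; last first.
    apply/eqP => Bx; have := @card_lump_twist _ _ lam xs B finset.set0.
    by rewrite Bx x_def => /(_ erefl)/eqP; rewrite cards0 cards_eq0 (negPf B0).
  rewrite -[_ *+ N]mulr_natr mulfVK //; apply/eqP; rewrite subr_eq0; apply/eqP.
  by apply: eq_bigr => i _; rewrite /V flip_twist.
by move=> p_le p_ge; split=> //; rewrite mul0r addr0 mulr1.
Qed.
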